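(* Let $p$ and $q$ be primes such that $(\mathbb{Z}/p\mathbb{Z})^\times$ has a subgroup $G$ of size $q$, let $\mathbb{H}=(\mathbb{Z}/p\mathbb{Z})/G$ be the $(p,q)$-hyperfield, and let $\zeta_q$ be a primitive $q$-th root of unity (in characteristic $0$). Then the submonoid $\operatorname{char}(\mathbb{H})$ is generated by the set $$\{p,q\}\ \cup\ \left\{\sum_{i=0}^{q-2}a_i \ \middle|\ a_0,\dots,a_{q-2}\in\mathbb{Z},\ 0\le a_i<p,\ N\left(\sum_{i=0}^{q-2}a_i\zeta_q^i\right)\equiv 0\pmod p\right\}.$$
   Context: Let $p$ be a prime and $G$ a subgroup of $(\mathbb{Z}/p\mathbb{Z})^\times$ of size $n$. The $(p,n)$-hyperfield $\mathbb{H}=(\mathbb{Z}/p\mathbb{Z})/G$ has as elements the orbits $[a]=\{ga: g\in G\}$, $a\in\mathbb{Z}/p\mathbb{Z}$; multiplication is $[a]\odot[b]=[ab]$, and the multivalued hyperaddition is $[a]\boxplus[b]=\{[c] : [c]\subseteq\{x+y : x\in[a],\ y\in[b]\}\}$, extended to non-empty subsets $A,B$ of $\mathbb{H}$ by $A\boxplus B=\bigcup_{\alpha\in A,\beta\in B}(\alpha\boxplus\beta)$. The zero element is $0=[0]$. For a natural number $k$ and $x\in\mathbb{H}$, $kx$ denotes the set $x\boxplus x\boxplus\cdots\boxplus x$ with $k$ copies of $x$ (the empty sum being $\{0\}$). The characteristic $\operatorname{char}(\mathbb{H})$ is the additive submonoid (containing $0$) of all natural numbers $k$ such that $0\in kx$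 for all $x\in\mathbb{H}$. A set $X$ of natural numbers generates a submonoid if the submonoid consists exactly of all finite non-negative integer combinations of elements of $X$. For $f(\zeta_n)=f_0+f_1\zeta_n+\cdots+f_k\zeta_n^k\in\mathbb{Z}[\zeta_n]$, with $\zeta_n$ a primitive $n$-th root of unity, the norm is the integer $N(f(\zeta_n))=\prod_{i\in(\mathbb{Z}/n\mathbb{Z})^\times}f(\zeta_n^i)$. *)

(* Defs.v *)
From HB Require Import structures.
From mathcomp Require Import all_boot all_order all_algebra all_fingroup.

Set Implicit Arguments.
Unset Strict Implicit.
Unset Printing Implicit Defensive.

Import GRing.Theory.
Local Open Scope ring_scope.

Section Hyperfield.

Variables (p : nat) (G : {group {unit 'F_p}}).

(* G acts on Z/pZ by the right multiplication action 'U, so the orbit of a is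
   {a * g | g in G}. The ring 'F_p is Z/pZ when p is prime. *)
Definition orb (a : 'F_p) : {set 'F_p} := orbit 'U G a.

Definition hyperfield : Type := {X : {set 'F_p} | X \in [set orb a | a : 'F_p]}.
HB.instance Definition _ := SubFinite.on hyperfield.

Lemma orb_subproof (a : 'F_p) : orb a \in [set orb b | b : 'F_p].
Proof. exact: imset_f. Qed.

Definition hclass (a : 'F_p) : hyperfield := Sub (orb a) (orb_subproof a).

Definition hzero : hyperfield := hclass 0.

Definition hadd (x y : hyperfield) : {set hyperfield} :=
  [set z : hyperfield | val z \subset [set u + v | u in val x, v in val y]].

Definition hadd_set (A B : {set hyperfield}) : {set hyperfield} :=
  \bigcup_(x in A) \bigcup_(y in B) hadd x y.

Fixpoint hmuln (k : nat) (x : hyperfield) : {set hyperfield} :=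
  match k with
  | 0 => [set hzero]
  | 1 => [set x]
  | k'.+1 => hadd_set (hmuln k' x) [set x]
  end.

Definition hchar (k : nat) : Prop := forall x : hyperfield, hzero \in hmuln k x.

End Hyperfield.

(* The pairs in s are (coefficient, element of X). *)
Definition generates (X M : nat -> Prop) : Prop :=
  forall k : nat, M k <->
    exists2 s : seq (nat * nat),
      (forall c, c \in s -> X c.2) & k = (\sum_(c <- s) c.1 * c.2)%N.

(* For zeta a primitive n-th root of unity, the norm N(f(zeta)) as an element
   of the ambient field; (Z/nZ)^* is represented by the i < n coprime to n. *)
Definition cyclo_norm (F : fieldType) (n : nat) (zeta : F) (f : {poly int}) : F :=
  \prod_(i < n | coprime i n) (map_poly intr f).[zeta ^+ i].

(* x is (the image of) an integer congruent to 0 mod p; that integer is unique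
   when F has characteristic 0. *)
Definition int_dvd_in (F : fieldType) (p : nat) (x : F) : Prop :=
  exists2 m : int, x = m%:~R & (m = 0 %[mod p])%Z.

Definition norm_generator (F : fieldType) (p q : nat) (zeta : F) (k : nat) : Prop :=
  exists a : 'I_q.-1 -> int,
    [/\ forall i, 0 <= a i < p%:Z,
        k%:Z = \sum_(i < q.-1) a i
      & int_dvd_in p (cyclo_norm q zeta (\sum_(i < q.-1) (a i)%:P * 'X^i))].

(* Main.v *)
(** Since G is generated by a primitive q-th root of unity w of F_p, k belongs to
    char(H) iff some combination \sum_(i < q) m_i w^i with natural coefficients
    of sum k vanishes in F_p. The norm of f(zeta) is an integer whose residue
    mod p is \prod_i f(w^i), so p divides it iff f vanishes at some w^i. For the
    remaining inclusion, since p = 0 and \sum_(i < q) w^i = 0 in F_p, one removes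
    multiples of p and of q from k to get 0 <= m_i < p with some m_j = 0, and
    then multiplies by a power of w to move that coefficient to w^(q-1). *)
Require Import Defs.
From mathcomp Require Import all_boot all_order all_algebra all_fingroup.
From mathcomp Require Import all_solvable all_field.
From Corelib Require Import RelationClasses.
Import GRing.Theory Pdiv.CommonRing Pdiv.RingMonic.
Local Open Scope ring_scope.

(** * Cyclotomic norms as integers, in characteristic 0 and modulo p *)

(** Since ['X^n - 1] is the product of the [Cyclotomic d] with d dividing n, z is a root of one of
    them. Then [z ^+ d = 1], so n divides d and d = n. The field may have any characteristic. *)
Lemma prim_root_Cyclotomic (K : fieldType) (n : nat) (z : K) :
  n.-primitive_root z -> root (map_poly intr (Cyclotomic n)) z.
Proof.
move=> prim_z; have n_gt0 := prim_order_gt0 prim_z.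
have unityP d : d.-unity_root z = (n %| d)%N.
  by rewrite unity_rootE -(prim_order_dvd prim_z).
have root_prod (s : seq nat) :
    root (map_poly intr (\prod_(d <- s) Cyclotomic d)) z ->
    exists2 d, d \in s & root (map_poly intr (Cyclotomic d)) z.
  elim: s => [|d s IHs]; first by rewrite big_nil rmorph1 (negPf (root1 z)).
  rewrite big_cons rmorphM rootM => /orP[rd | /IHs[e es re]].
    by exists d; rewrite // mem_head.
  by exists e; rewrite // in_cons es orbT.
have [|d] := root_prod (divisors n).
  rewrite prod_Cyclotomic // rmorphB rmorph1 /= map_polyXn.
  by have:= unityP n; rewrite dvdnn.
rewrite -dvdn_divisors // => d_dv_n rd.
suffices /eqP->: n == d by [].
have d_gt0 := dvdn_gt0 n_gt0 d_dv_n.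
rewrite eqn_dvd d_dv_n andbT -unityP /root_of_unity.
have ->: 'X^d - 1 = map_poly intr ('X^d - 1) :> {poly K}.
  by rewrite rmorphB rmorph1 /= map_polyXn.
rewrite -prod_Cyclotomic // (big_rem d) -?dvdn_divisors //=.
by rewrite rmorphM rootM rd.
Qed.

(** Here w is a power of z with exponent e coprime to n, and multiplication by e permutes the units
    modulo n. *)
Lemma cyclo_norm_prim_root (K : fieldType) (n : nat) (z w : K) f :
  n.-primitive_root z -> n.-primitive_root w ->
  cyclo_norm n w f = cyclo_norm n z f.
Proof.
move=> prim_z prim_w; have n_gt0 := prim_order_gt0 prim_z.
have [e Dw] := prim_rootP prim_z (prim_expr_order prim_w).
have co_e_n: coprime e n by rewrite -(prim_root_exp_coprime e prim_z) -Dw.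
pose h e (k : 'I_n) := Ordinal (ltn_pmod (k * e) n_gt0).
have inj_h: injective (h e).
  (* The Bezout coefficient of e is an inverse of e modulo n. *)
  apply: can_inj (h (egcdn e n).1) _ => k; apply: val_inj => /=.
  rewrite modnMml -mulnA -modnMmr -{1}(mul1n e).
  by rewrite (chinese_modr co_e_n 0) modnMmr muln1 modn_small.
rewrite /cyclo_norm [RHS](reindex_inj inj_h); apply: eq_big => k /=.
  by rewrite coprime_modl coprimeMl co_e_n andbT.
by rewrite prim_expr_mod // mulnC exprM -Dw.
Qed.

(* The remainder of \prod_i f(X^i) modulo 'Phi_n takes the same value at all the
   totient n primitive roots in algC; having degree less than totient n, it is
   constant. *)
Lemma cyclo_norm_int (n : nat) (f : {poly int}) : exists r : int,
  forall (K : fieldType) (z : K), n.-primitive_root z ->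
    cyclo_norm n z f = r%:~R.
Proof.
have [->|n_gt0] := posnP n.
  by exists 0 => K z /prim_order_gt0.
pose P := \prod_(i < n | coprime i n) (f \Po 'X^i).
have [mon_Phi Phi_neq0] := (Cyclotomic_monic n, monic_neq0 (Cyclotomic_monic n)).
(* The divisor is monic, so the division takes place over [int] and its identity maps to every
   field, ['F_p] included. *)
pose r := rmodp P (Cyclotomic n).
have hornerP (K : fieldType) (z : K) : n.-primitive_root z ->
    (map_poly intr r).[z] = cyclo_norm n z f.
  move=> prim_z; transitivity (map_poly intr P).[z].
    rewrite [in RHS](rdivp_eq mon_Phi P) rmorphD rmorphM hornerD hornerM.
    by rewrite (rootP (prim_root_Cyclotomic _ _ _ prim_z)) mulr0 add0r.
  rewrite rmorph_prod horner_prod; apply: eq_bigr => i _.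
  by rewrite /= map_comp_poly /= map_polyXn horner_comp hornerXn.
have [z prim_z] := C_prim_root_exists n_gt0.
pose N := cyclo_norm n z f.
have Dr: map_poly intr r = N%:P :> {poly algC}.
  apply/eqP; rewrite -subr_eq0; apply: contraT => nz_rN.
  pose rs := [seq z ^+ i | i : 'I_n in [pred i : 'I_n | coprime i n]].
  have prim_rs: {in rs, forall w, n.-primitive_root w}.
    by move=> _ /imageP[i co_i_n ->]; rewrite prim_root_exp_coprime.
  have uniq_rs: uniq rs.
    rewrite map_inj_uniq ?enum_uniq // => i j /eqP.
    by rewrite (eq_prim_root_expr prim_z) !modn_small // => /eqP/val_inj.
  have size_rs: size rs = totient n.
    rewrite size_map -cardE totient_count_coprime -big_mkcond big_mkord -sum1_card.
    by apply: eq_bigl => k; rewrite coprime_sym.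
  have /(max_poly_roots nz_rN)/(_ uniq_rs): all (root (map_poly intr r - N%:P)) rs.
    apply/allP=> w /prim_rs prim_w; rewrite rootE hornerD hornerN hornerC.
    by rewrite hornerP // (cyclo_norm_prim_root _ _ _ _ _ prim_z) // subrr.
  have := ltn_rmodp P (Cyclotomic n); rewrite Phi_neq0 size_Cyclotomic ltnS => le_r.
  rewrite size_rs ltnNge => /negP[]; rewrite (leq_trans (size_polyD _ _)) //.
  rewrite geq_max size_polyN (leq_trans (size_poly _ _)) //=.
    by rewrite (leq_trans (size_polyC_leq1 _)) // totient_gt0.
exists r`_0 => K w prim_w; rewrite -hornerP //.
(* Integers embed in [algC], so r is already constant over [int], and its value is the same in every
   field. *)
suffices ->: r = (r`_0)%:P by rewrite map_polyC hornerC coefC.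
apply/polyP=> [[|i]]; rewrite coefC //=; apply: (@intr_inj algC).
by rewrite -coef_map Dr coefC.
Qed.

Lemma intr_eq0_pchar0 (R : idomainType) (m : int) :
  [pchar R] =i pred0 -> (m%:~R == 0 :> R) = (m == 0).
Proof.
move=> R0; have {}R0 := proj1 (pcharf0P R) R0.
by case: m => n; rewrite ?NegzE ?mulrNz ?oppr_eq0 -pmulrn R0.
Qed.

Lemma intr_Fp_eq0 (p : nat) (m : int) :
  prime p -> (m%:~R == 0 :> 'F_p) = (m == 0 %[mod p])%Z.
Proof.
move=> p_pr; rewrite mod0z.
have pn n : (n%:R == 0 :> 'F_p) = (p %| n)%N by rewrite (dvdn_pcharf (pchar_Fp p_pr)).
transitivity (p %| `|m|)%N; last by rewrite -[LHS]/(p %| m)%Z (sameP dvdz_mod0P eqP).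
by case: m => n; rewrite ?NegzE ?mulrNz ?oppr_eq0 ?abszN -pmulrn pn.
Qed.

(** The norms at zeta and at w are images of one integer r. Characteristic 0 makes r the only
    integer with its image in F, and r vanishes in ['F_p] iff some factor f(w^i) does. *)
Lemma int_dvd_cyclo_norm (p n : nat) (F : fieldType) (zeta : F) (w : 'F_p) f :
    prime p -> [pchar F] =i pred0 ->
    n.-primitive_root zeta -> n.-primitive_root w ->
  int_dvd_in p (cyclo_norm n zeta f) <->
  exists2 i : 'I_n, coprime i n & root (map_poly intr f) (w ^+ i).
Proof.
move=> p_pr F0 prim_zeta prim_w; have [r Nr] := cyclo_norm_int n f.
transitivity (cyclo_norm n w f == 0).
  rewrite (Nr _ _ prim_zeta) (Nr _ _ prim_w) intr_Fp_eq0 //.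
  split=> [[m /eqP Drm /eqP m0] | /eqP r0]; last by exists r.
  suffices /eqP->: r == m by [].
  by rewrite -subr_eq0 -(intr_eq0_pchar0 F _ F0) intrB subr_eq0.
by split=> [/prodf_eq0 | exi]; [| apply/prodf_eq0].
Qed.

(** * From iterated hyperaddition of orbits to sums in ['F_p] *)

Section Orbits.

Variables (p : nat) (G : {group {unit 'F_p}}).
Implicit Types (a b c : 'F_p) (x : hyperfield G).

Lemma orbP a b : reflect (exists2 g, g \in G & b = a * val g) (b \in orb G a).
Proof. by apply: (iffP orbitP) => -[g Gg]; [move<- | move->]; exists g. Qed.

Lemma orb_refl a : a \in orb G a.
Proof. exact: orbit_refl. Qed.

Lemma orb_eq a b : (orb G a == orb G b) = (a \in orb G b).
Proof. exact: orbit_eq_mem. Qed.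

Lemma orb_mul a b : (b \in orb G a) <-> exists2 u, u \in orb G 1 & b = a * u.
Proof.
split=> [/orbP[g Gg ->] | [_ /orbP[g Gg ->] ->]].
  by exists (val g) => //; apply/orbP; exists g; rewrite ?mul1r.
by rewrite mul1r; apply/orbP; exists g.
Qed.

Lemma hyperfieldP x : exists a, x = hclass G a.
Proof.
by have /imsetP[a _ Dx] := valP x; exists a; apply: val_inj.
Qed.

Lemma hclass_eq a b : (hclass G a == hclass G b) = (a \in orb G b).
Proof. by rewrite -val_eqE /= orb_eq. Qed.

(** The sumset of two orbits is stable under G, so it contains an orbit as soon as it contains one
    element of it. *)
Lemma hclass_hadd a b c :
  (hclass G c \in hadd (hclass G a) (hclass G b)) =
  (c \in [set u + v | u in orb G a, v in orb G b]).
Proof.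
rewrite inE /=; apply/subsetP/idP => [-> // | /imset2P[u v au bv ->] d].
  exact: orb_refl.
case/orbP=> g Gg ->; rewrite mulrDl; apply: imset2_f.
  by rewrite -orb_eq in au; rewrite -orb_eq -(eqP au) orb_eq; apply/orbP; exists g.
by rewrite -orb_eq in bv; rewrite -orb_eq -(eqP bv) orb_eq; apply/orbP; exists g.
Qed.


Definition sums (A : {set 'F_p}) (k : nat) (c : 'F_p) : Prop :=
  exists s : seq 'F_p, [/\ size s = k, all (mem A) s & c = \sum_(u <- s) u].

Lemma hmulnP k a c : hclass G c \in hmuln k (hclass G a) <-> sums (orb G a) k c.
Proof.
have hzeroP d : (hclass G d == hzero G) = (d == 0).
  rewrite hclass_eq; apply/orbP/eqP => [[g _ ->] | ->]; first by rewrite mul0r.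
  by exists 1%g; rewrite ?group1 ?mul0r.
(* The cases 0 and 1 are separate, as in [hmuln]. *)
elim: k c => [|[|k] IHk] c.
- rewrite inE hzeroP; split=> [/eqP-> | [[|? ?] [// _ _ ->]]].
    by exists [::]; rewrite big_nil.
  by rewrite big_nil.
- rewrite inE hclass_eq; split=> [ca | [[|? [|? ?]] [//= _ + ->]]].
    by exists [:: c]; rewrite big_seq1 /= ca.
  by rewrite andbT big_seq1.
transitivity (exists2 d, sums (orb G a) k.+1 d & exists2 u, u \in orb G a & c = d + u).
  split=> [/bigcupP[x] | [d /IHk kd [u au ->]]].
    have [d ->] := hyperfieldP x => /IHk[s [sz_s As Dd]] /bigcupP[_ /set1P->].
    rewrite hclass_hadd => /imset2P[v u /orbP[g Gg ->] au ->].
    (* The element met in the class of d is d g; multiplying every summand of d by g keeps it in the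
       orbit of a. *)
    exists (d * val g); last by exists u.
    exists [seq v * val g | v <- s]; rewrite size_map big_map -mulr_suml -Dd.
    split=> //; rewrite all_map; apply: sub_all As => w /= /orbP[h Gh ->].
    by apply/orbP; exists (h * g)%g; rewrite ?groupM //= mulrA.
  apply/bigcupP; exists (hclass G d) => //; apply/bigcupP; exists (hclass G a).
    exact: set11.
  by rewrite hclass_hadd imset2_f ?orb_refl.
split=> [[_ [s [sz_s As ->]] [u au ->]] | [[|u s] [//= [sz_s] /andP[au As] ->]]].
  by exists (u :: s); rewrite /= sz_s au big_cons addrC.
by exists (\sum_(v <- s) v); [exists s | exists u; rewrite // big_cons addrC].
Qed.

(** Multiplication by a carries a vanishing sum over the orbit of 1 to one over the orbit of a, so
    the class of 1 decides for all. *)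
Lemma hcharP k : hchar G k <-> sums (orb G 1) k 0.
Proof.
split=> [/(_ (hclass G 1))/hmulnP // | [s [sz_s Gs s0]] x].
have [a ->] := hyperfieldP x; apply/hmulnP; exists [seq a * u | u <- s].
rewrite size_map big_map -mulr_sumr -s0 mulr0; split=> //.
rewrite all_map; apply: sub_all Gs => u Gu; apply/orb_mul; by exists u.
Qed.

End Orbits.

(** * Sums with multiplicities *)

Section Sums.

Variables (p : nat).
Implicit Types (A : {set 'F_p}).

Lemma sums0 A : sums p A 0 0.
Proof. by exists [::]; rewrite big_nil. Qed.

Lemma sumsD A k l c d : sums p A k c -> sums p A l d -> sums p A (k + l) (c + d).
Proof.
move=> [s [<- As ->]] [t [<- At ->]].
by exists (s ++ t); rewrite size_cat all_cat big_cat As At.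
Qed.

Lemma sums_nat A k u : u \in A -> sums p A k (u *+ k).
Proof.
move=> Au; exists (nseq k u); rewrite size_nseq all_nseq /= Au orbT.
by rewrite big_nseq iter_addr_0.
Qed.

Lemma sums_sum A (I : finType) (v : I -> 'F_p) (m : I -> nat) :
  (forall i, v i \in A) -> sums p A (\sum_i m i) (\sum_i v i *+ m i).
Proof.
move=> Av; apply: (big_ind2 (sums p A)); first exact: sums0.
  by move=> *; apply: sumsD.
by move=> i _; apply: sums_nat.
Qed.

(** Each summand is charged to one index that v sends to it; [m] counts these charges. *)
Lemma sums_imset (I : finType) (v : I -> 'F_p) k c :
  sums p [set v i | i : I] k c <->
  exists m : I -> nat, k = (\sum_i m i)%N /\ c = \sum_i v i *+ m i.
Proof.
split=> [[s [<- + ->]] | [m [-> ->]]]; last first.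
  by apply: sums_sum => i; apply: imset_f.
elim: s => [_ | u s IHs /andP[/imsetP[i _ ->] /IHs[m [Dk Ds]]]].
  by exists (fun=> 0%N); rewrite big_nil !big1.
exists (fun j => (j == i) + m j)%N; split.
  rewrite big_split /= Dk -add1n; congr (_ + _)%N.
  by rewrite (bigD1 i) //= eqxx big1 // => j /negPf->.
rewrite big_cons Ds; under [RHS]eq_bigr do rewrite mulrnDr.
rewrite big_split /=; congr (_ + _); rewrite (bigD1 i) //= eqxx mulr1n big1 ?addr0 // => j.
by move/negPf->.
Qed.

Lemma Fp_mulrn (u : 'F_p) k : prime p -> u *+ (k * p) = 0.
Proof. by move=> p_pr; rewrite -mulr_natr natrM (pchar_Fp_0 p_pr) !mulr0. Qed.

End Sums.

(** * Powers of a primitive root of unity and their linear relations *)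

Lemma unit_prim_root (R : finFieldType) (x : {unit R}) :
  #[x]%g.-primitive_root (val x).
Proof.
rewrite /primitive_root_of_unity order_gt0 /=.
apply/forallP=> i; rewrite unity_rootE -FinRing.val_unitX -[1](FinRing.val_unit1) val_eqE.
rewrite -order_dvdn; apply/eqP; apply/idP/eqP=> [dvd_i | ->//].
by apply/eqP; rewrite eqn_leq ltn_ord dvdn_leq.
Qed.

(** The orbit of 1 is G itself, and a finite group of units of a field is cyclic; w is a
    generator. *)
Lemma orb1_powers (p : nat) (G : {group {unit 'F_p}}) :
  exists2 w : 'F_p, #|G|.-primitive_root w & orb G 1 = [set w ^+ i | i : 'I_#|G|].
Proof.
have /cyclicP[x DG] := field_unit_group_cyclic G.
exists (val x); first by rewrite DG; apply: unit_prim_root.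
apply/setP=> u; apply/orbP/imsetP=> [[g + ->] | [i _ ->]].
  rewrite DG => /cyclePmin[i lt_i ->].
  by exists (Ordinal lt_i); rewrite // mul1r FinRing.val_unitX.
by exists (x ^+ i)%g; rewrite ?mul1r ?FinRing.val_unitX // groupX // DG cycle_id.
Qed.

Lemma sum_prim_root (K : fieldType) (n : nat) (w : K) :
  (1 < n)%N -> n.-primitive_root w -> \sum_(i < n) w ^+ i = 0.
Proof.
move=> n_gt1 prim_w; have /eqP := subrX1 w n.
rewrite (prim_expr_order prim_w) subrr eq_sym mulf_eq0 subr_eq0.
case/orP=> [/eqP w1 | /eqP//].
have := prim_order_dvd prim_w 1; rewrite expr1 w1 eqxx dvdn1 => /eqP n1.
by rewrite n1 in n_gt1.
Qed.

Lemma horner_coef_sum (K : fieldType) (n : nat) (a : 'I_n -> int) (z : K) :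
  (map_poly intr (\sum_(i < n) (a i)%:P * 'X^i)).[z] = \sum_(i < n) (a i)%:~R * z ^+ i.
Proof.
rewrite rmorph_sum horner_sum; apply: eq_bigr => i _.
by rewrite rmorphM /= map_polyC map_polyXn hornerM hornerC hornerXn.
Qed.

(** The coefficients are reduced modulo p, lowered by their minimum, then rotated so that a zero
    falls on the last exponent q'. *)
Lemma reduce_relation (p q' : nat) (w : 'F_p) (m : 'I_q'.+1 -> nat) :
    prime p -> prime q'.+1 -> q'.+1.-primitive_root w ->
    \sum_(i < q'.+1) w ^+ i *+ m i = 0 ->
  exists a b (e : 'I_q' -> nat),
    [/\ (\sum_i m i = a * p + b * q'.+1 + \sum_i e i)%N,
        forall i, (e i < p)%N & \sum_(i < q') w ^+ i *+ e i = 0].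
Proof.
move=> p_pr q_pr prim_w sum_m.
pose d i := (m i %% p)%N; have [j _ min_j] := @arg_minnP _ ord0 xpredT d isT.
(* Addition in ['I_q'.+1] is modulo q'+1, so [h] is the rotation that sends [ord_max] to the
   minimizing index j. *)
pose l : 'I_q'.+1 := j - ord_max; pose h (i : 'I_q'.+1) : 'I_q'.+1 := i + l.
pose e (i : 'I_q'.+1) := (d (h i) - d j)%N.
have inj_h : injective h by apply: addIr.
have De i : d (h i) = (e i + d j)%N by rewrite subnK ?min_j.
have e_max : e ord_max = 0%N by rewrite /e /h addrC subrK subnn.
have w_neq0 : w != 0.
  apply/eqP=> w0; have /eqP := prim_expr_order prim_w.
  by rewrite w0 expr0n eq_sym oner_eq0.
have sum_d : \sum_(i < q'.+1) w ^+ i *+ d i = 0.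
  rewrite -[RHS]sum_m; apply: eq_bigr => i _.
  by rewrite [in RHS](divn_eq (m i) p) mulrnDr Fp_mulrn // add0r.
have sum_e : \sum_(i < q'.+1) w ^+ i *+ e i = 0.
  (* Multiplying by [w ^+ l] undoes the rotation; the subtracted constant [d j] contributes a
     multiple of the sum of all powers of w, which is 0. *)
  apply: (mulfI (expf_neq0 l w_neq0)); rewrite mulr0 -[RHS]sum_d.
  rewrite [RHS](reindex_inj inj_h) mulr_sumr.
  have wl i : w ^+ h i = w ^+ l * w ^+ i.
    by rewrite /= prim_expr_mod // addnC exprD.
  under [RHS]eq_bigr => i _ do rewrite De wl mulrnDr -!mulrnAr.
  rewrite big_split /= -!mulr_sumr sumrMnl (sum_prim_root _ _ _ _ prim_w) ?prime_gt1 //.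
  by rewrite mul0rn mulr0 addr0.
(* The quotients count copies of p, the minimum counts copies of q'+1, and the last coefficient,
   being 0, is dropped. *)
exists (\sum_i m i %/ p)%N, (d j), (fun i => e (widen_ord (leqnSn q') i)); split.
- rewrite -[LHS](eq_bigr _ (fun i _ => esym (divn_eq (m i) p))) big_split /= -big_distrl /=.
  rewrite -addnA; congr (_ + _)%N; rewrite -/d.
  rewrite (reindex_inj inj_h) (eq_bigr _ (fun i _ => De i)) big_split /=.
  by rewrite sum_nat_const card_ord big_ord_recr /= e_max addn0 addnC mulnC.
- by move=> i; rewrite (leq_ltn_trans (leq_subr _ _)) // ltn_mod prime_gt0.
- by move: sum_e; rewrite big_ord_recr /= e_max mulr0n addr0.
Qed.

(** * Generators of the characteristic *)

Theorem theorem10 (p q : nat) (G : {group {unit 'F_p}})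
    (F : fieldType) (zeta : F) :
  prime p -> prime q -> #|G| = q ->
  [pchar F] =i pred0 -> q.-primitive_root zeta ->
  generates (fun k => k = p \/ k = q \/ norm_generator p q zeta k) (hchar G).
Proof.
move=> p_pr q_pr cardG F0 prim_zeta.
have [w] := orb1_powers p G; rewrite cardG => prim_w orb1.
have mem_orb i : w ^+ i \in orb G 1.
  rewrite orb1 -(prim_expr_mod prim_w); apply/imsetP.
  by exists (Ordinal (ltn_pmod i (prime_gt0 q_pr))).
pose char k := sums p (orb G 1) k 0.
have charD k l : char k -> char l -> char (k + l)%N.
  by move=> ck cl; rewrite /char -[0]addr0; apply: sumsD.
have charM k l : char l -> char (k * l)%N.
  by move=> cl; elim: k => [|k IHk]; [exact: sums0 | rewrite mulSn; apply: charD].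
move=> k; apply: iff_trans (hcharP p G k) _; split.
- rewrite orb1 => /sums_imset[m [-> /esym sum_m]].
  (* Writing q as q'+1 turns the index type ['I_q.-1] into ['I_q']. *)
  case: q => [|q'] in q_pr cardG prim_zeta prim_w orb1 m sum_m * => //.
  have [a [b [e [-> lt_e sum_e]]]] := reduce_relation _ _ _ _ p_pr q_pr prim_w sum_m.
  exists [:: (a, p); (b, q'.+1); (1%N, \sum_i e i)%N]; last first.
    by rewrite !big_cons big_nil /= mul1n addn0 addnA.
  move=> c; rewrite !inE => /or3P[] /eqP->; [by left | by right; left | right; right].
  exists (fun i => (e i)%:Z); split=> [i||].
  + by rewrite ltz_nat lt_e.
  + by rewrite /= (big_morph Posz PoszD erefl).
  apply/(int_dvd_cyclo_norm _ _ _ _ _ _ p_pr F0 prim_zeta prim_w).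
  (* The exponent 1 is below q and coprime to it: w itself is the root. *)
  exists (Ordinal (prime_gt1 q_pr)); first exact: coprime1n.
  rewrite rootE horner_coef_sum -[X in _ == X]sum_e; apply/eqP/eq_bigr => i _.
  by rewrite expr1 -mulr_natl.
(* Conversely, closure under sums and multiples leaves only the generators to check. *)
case=> s Xs ->; elim: s => [|[c x] s IHs] in Xs *; first by rewrite big_nil; apply: sums0.
rewrite big_cons; apply: charD; last by apply: IHs => d sd; apply: Xs; rewrite inE sd orbT.
apply: charM; have /= := Xs (c, x) (mem_head _ _).
case=> [-> | [-> | [a [a_bnd Dx dvd_a]]]].
(* p copies of 1, the zeroth power of w, sum to 0. *)
- have := sums_nat p _ p _ (mem_orb 0%N).
  by rewrite -[X in _ *+ X]mul1n Fp_mulrn.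
(* Each of the q powers of w is taken once. *)
- have := sums_sum p (orb G 1) _ (fun i : 'I_q => w ^+ i) (fun=> 1%N) (fun i => mem_orb i).
  by rewrite sum1_card card_ord sum_prim_root ?prime_gt1.
move: dvd_a => /(int_dvd_cyclo_norm _ _ _ _ _ _ p_pr F0 prim_zeta prim_w) [i _].
rewrite rootE horner_coef_sum => /eqP sum_a.
have a_abs j : a j = `|a j|%N by have /andP[/gez0_abs->] := a_bnd j.
have Dx' : x = (\sum_j `|a j|)%N.
  apply/eqP; rewrite -eqz_nat Dx; apply/eqP.
  by rewrite (big_morph Posz PoszD erefl); apply: eq_bigr.
rewrite Dx'.
(* The polynomial vanishes at [w ^+ i], so taking [w ^+ (i * j)] with multiplicity [a j] for each j
   gives a vanishing sum of x elements of the orbit. *)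
have := sums_sum p (orb G 1) _ (fun j : 'I_q.-1 => w ^+ (i * j)) (fun j => `|a j|%N)
   (fun j => mem_orb _).
rewrite /char; congr sums; rewrite -[RHS]sum_a; apply: eq_bigr => j _.
by rewrite exprM -mulr_natl [in RHS]a_abs.
Qed.
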